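(* If $f\in\mathcal{L}^E$ is satisfied in some belief structure (resp. possibility structure), then $f$ is satisfied in a belief structure (resp. possibility structure) $(W,\nu,\pi)$ such that $|W|\le|f|^2$, the mass function corresponding to $\nu$ is positive on at most $|f|$ subsets of $W$, the mass of each of these subsets is a rational number of size $O(|f|\,\|f\|+|f|\log|f|)$, and $\pi(w)(p)=\text{false}$ for every $w\in W$ and every primitive proposition $p$ not appearing in $f$.
   Context: Language $\mathcal L^E$: fix primitive propositions $\Phi_0$; propositional formulas built with $\neg,\wedge$; $\mathit{true}$ a tautology. A propositional gamble is $b_1\phi_1+\cdots+b_n\phi_n$ (integers $b_i$); formulas are Boolean combinations of expectation inequalities $a_1e(\gamma_1)+\cdots+a_ke(\gamma_k)\ge b$ (integers $a_i,b$). A belief structure is $(W,\mathrm{Bel},\pi)$ with $W$ nonempty, $\mathrm{Bel}$ a belief function on $W$ ($\mathrm{Bel}(\emptyset)=0$, $\mathrm{Bel}(W)=1$, $\mathrm{Bel}(\bigcup_{i=1}^nU_i)\ge\sum_{\emptyset\ne I\subseteq\{1..n\}}(-1)^{|I|+1}\mathrm{Bel}(\bigcap_{j\in I}U_j)$), $\pi$ a truth assignment to $\Phi_0$ at each world; a possibility structure is $(W,\mathrm{Poss},\pi)$ with $\mathrm{Poss}(\emptyset)=0$, $\mathrm{Poss}(W)=1$, $\mathrm{Poss}(U\cup V)=\max(\mathrm{Poss}(U),\mathrm{Poss}(V))$. $[\![\phi]\!]_M$ is the set of worlds satisfying $\phi$, $[\![\sum b_i\phi_i]\!]_M=\sum b_iX_{[\![\phi_i]\!]_M}$;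 for a finite-range gamble $X$ with values $x_1<\cdots<x_n$ and $\nu\in\{\mathrm{Bel},\mathrm{Poss}\}$, $E_\nu(X)=x_1+\sum_{i<n}(x_{i+1}-x_i)\nu(X>x_i)$; $M\models\sum a_ie(\gamma_i)\ge b$ iff $\sum a_iE_\nu([\![\gamma_i]\!]_M)\ge b$. The mass function of a belief function $\mathrm{Bel}$ on finite $W$ is the unique $m:2^W\to[0,1]$ with $m(\emptyset)=0$ and $\mathrm{Bel}(U)=\sum_{V\subseteq U}m(V)$; the mass function of a possibility measure $\mathrm{Poss}$ is that of the belief function $U\mapsto1-\mathrm{Poss}(W\setminus U)$. $|f|$ is the number of symbols in $f$ (each coefficient one symbol); $\|f\|$ is the binary length of the longest coefficient; size of rational $a/b$ in lowest terms is $\|a\|+\|b\|$. *)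

(* Defs.v *)
From HB Require Import structures.
From mathcomp Require Import all_boot all_order all_algebra.
From mathcomp Require Import boolp classical_sets reals.
From Stdlib Require Import PeanoNat.

Set Implicit Arguments.
Unset Strict Implicit.
Unset Printing Implicit Defensive.

Import Order.TTheory GRing.Theory Num.Theory.
Local Open Scope classical_set_scope.
Local Open Scope ring_scope.

Inductive pform : Type :=
| PAtom of nat
| PNot of pform
| PAnd of pform & pform.

(* propositional gamble  b_1 phi_1 + ... + b_n phi_n *)
Definition gamble := seq (int * pform).

(* Boolean combinations of  a_1 e(g_1) + ... + a_k e(g_k) >= b *)
Inductive fml : Type :=
| Ineq of seq (int * gamble) & int
| FNot of fml
| FAnd of fml & fml.

(* |f| : number of symbols, each coefficient counting as one symbol.  *)
Fixpoint psize (p : pform) : nat :=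
  match p with
  | PAtom _ => 1
  | PNot q => (psize q).+1
  | PAnd q r => (psize q + psize r).+1
  end.

(* b_1 phi_1 + ... + b_n phi_n : n coefficients, the phi_i, n-1 plus signs *)
Definition gsize (g : gamble) : nat :=
  (\sum_(t <- g) (1 + psize t.2))%N + (size g).-1.

(* a_1 e(g_1) + ... + a_k e(g_k) >= b : k coefficients, k symbols e,
   the g_i, k-1 plus signs, the symbol >= and the coefficient b *)
Fixpoint fsize (f : fml) : nat :=
  match f with
  | Ineq ts b => ((\sum_(t <- ts) (2 + gsize t.2))%N + (size ts).-1 + 2)%N
  | FNot g => (fsize g).+1
  | FAnd g h => (fsize g + fsize h).+1
  end.

(* binary length of an integer (of its absolute value; 0 has length 1) *)
Definition bitlen (z : int) : nat := (Nat.log2 (absz z)).+1.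

Definition gmaxlen (g : gamble) : nat := (\max_(t <- g) bitlen t.1)%N.

Fixpoint fmaxlen (f : fml) : nat :=
  match f with
  | Ineq ts b => maxn (bitlen b) (\max_(t <- ts) maxn (bitlen t.1) (gmaxlen t.2))%N
  | FNot g => fmaxlen g
  | FAnd g h => maxn (fmaxlen g) (fmaxlen h)
  end.

Definition ratsize (q : rat) : nat := (bitlen (numq q) + bitlen (denq q))%N.

Fixpoint patoms (p : pform) : seq nat :=
  match p with
  | PAtom n => [:: n]
  | PNot q => patoms q
  | PAnd q r => patoms q ++ patoms r
  end.

Definition gatoms (g : gamble) : seq nat := flatten (map (fun t => patoms t.2) g).

Fixpoint fatoms (f : fml) : seq nat :=
  match f with
  | Ineq ts _ => flatten (map (fun t => gatoms t.2) ts)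
  | FNot g => fatoms g
  | FAnd g h => fatoms g ++ fatoms h
  end.

Section Semantics.
Variables (R : realType) (W : Type).

Definition is_belief (nu : set W -> R) : Prop :=
  [/\ nu set0 = 0, nu setT = 1,
      (forall U, 0 <= nu U <= 1) &
      forall (n : nat) (U : 'I_n -> set W),
        \sum_(I : {set 'I_n} | (0 < #|I|)%N)
            (-1) ^+ (#|I|.+1) * nu [set w | forall j, j \in I -> U j w]
        <= nu [set w | exists j, U j w]].

Definition is_possibility (nu : set W -> R) : Prop :=
  [/\ nu set0 = 0, nu setT = 1 &
      forall U V, nu (U `|` V) = Num.max (nu U) (nu V)].

Variable pi : W -> nat -> bool.

Fixpoint peval (w : W) (p : pform) : bool :=
  match p with
  | PAtom n => pi w n
  | PNot q => ~~ peval w q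
  | PAnd q r => peval w q && peval w r
  end.

Definition pden (p : pform) : set W := [set w | peval w p].

Definition gval (g : gamble) (w : W) : int :=
  \sum_(t <- g) (if peval w t.2 then t.1 else 0).

(* all subset sums of the coefficients: a finite superset of the range *)
Fixpoint gcands (g : gamble) : seq int :=
  match g with
  | [::] => [:: 0]
  | t :: g' => gcands g' ++ map (fun v => v + t.1) (gcands g')
  end.

Definition grange (g : gamble) : seq int :=
  sort (fun x y : int => x <= y)
    (undup (filter (fun v => `[< exists w, gval g w = v >]) (gcands g))).

Fixpoint esum (nu : set W -> R) (X : W -> int) (xs : seq int) : R :=
  match xs with
  | x :: ((y :: _) as rest) =>
      (y - x)%:~R * nu [set w | x < X w] + esum nu X rest
  | _ => 0
  end.

Definition Echoquet (nu : set W -> R) (X : W -> int) (xs : seq int) : R :=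
  match xs with
  | x :: _ => x%:~R + esum nu X xs
  | [::] => 0
  end.

Definition expect (nu : set W -> R) (g : gamble) : R :=
  Echoquet nu (gval g) (grange g).

Fixpoint sat (nu : set W -> R) (f : fml) : Prop :=
  match f with
  | Ineq ts b => b%:~R <= \sum_(t <- ts) t.1%:~R * expect nu t.2
  | FNot g => ~ sat nu g
  | FAnd g h => sat nu g /\ sat nu h
  end.

End Semantics.

Definition is_mass (R : realType) (W : finType) (nu : set W -> R)
  (m : {set W} -> R) : Prop :=
  m (finset.set0 : {set W}) = 0 /\
  forall U : {set W}, nu [set w | w \in U] = \sum_(V : {set W} | V \subset U) m V.

Definition poss_dual (R : realType) (W : Type) (nu : set W -> R) : set W -> R :=
  fun U => 1 - nu (~` U).

(* Main.v *)
(** Only finitely many truth assignments to the atoms of [f] matter, so the given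
    measure induces one on a finite quotient of the worlds, where it is a convex
    combination of focal sets: by Moebius inversion for a belief function, along
    a chain for a possibility measure.  The expectation of a gamble is then the
    weighted sum of its minima (resp. maxima) on the focal sets, so that the truth
    values of the inequalities of [f] become sign conditions on integer linear
    forms in the weights.  A solution with minimal support of this homogeneous
    system has at most one focal set per condition, and Cramer's rule bounds its
    weights.  Finally each focal set is replaced by witnesses of the extrema of
    the gambles of [f] on it.  Working with a homogeneous system and normalising
    only at the end makes strict inequalities harmless. *)

From Stdlib Require PeanoNat.
Require Import Defs.
From HB Require Import structures.
From mathcomp Require Import all_boot all_order all_algebra.
From mathcomp Require Import boolp classical_sets reals.
From mathcomp Require Import perm zify.
Set Implicit Arguments.
Unset Strict Implicit.
Unset Printing Implicit Defensive.
Import Order.TTheory GRing.Theory Num.Theory.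
Local Open Scope classical_set_scope.
Local Open Scope ring_scope.

(** * Small solutions of integer linear systems *)

Lemma det_norm_le n (B : nat) (Q : 'M[int]_n) :
  (forall i j, `|Q i j| <= B%:Z) -> `|\det Q| <= (n`! * B ^ n)%N%:Z.
Proof.
move=> QB; apply: (le_trans (ler_norm_sum _ _ _)).
apply: (@le_trans _ _ (\sum_(s : 'S_n) B%:Z ^+ n)); last first.
  by rewrite sumr_const card_Sn -mulr_natl -!natz natrM natrX.
apply: ler_sum => s _; rewrite normrM normrX normrN1 expr1n mul1r normr_prod.
rewrite -[leRHS]mul1r -[in leRHS](card_ord n) -prodr_const mul1r.
by apply: ler_prod => i _; rewrite normr_ge0 QB.
Qed.

Lemma cofactor_norm_le n (B : nat) (Q : 'M[int]_n) i j :
  (forall i j, `|Q i j| <= B%:Z) ->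
  `|cofactor Q i j| <= (n.-1`! * B ^ n.-1)%N%:Z.
Proof.
move=> QB; rewrite /cofactor normrM normrX normrN1 expr1n mul1r.
by apply: det_norm_le => a b; rewrite !mxE.
Qed.

(** These are the numerators in Cramer's rule: [n] cofactors, each times an entry of [e], which
    gives the same bound as for [\det Q]. *)
Lemma adj_mul_norm_le n (B : nat) (Q : 'M[int]_n) (e : 'cV[int]_n) i :
  (forall i j, `|Q i j| <= B%:Z) -> (forall i, `|e i 0| <= B%:Z) ->
  `|(\adj Q *m e) i 0| <= (n`! * B ^ n)%N%:Z.
Proof.
move=> QB eB; rewrite mxE; apply: (le_trans (ler_norm_sum _ _ _)).
apply: (@le_trans _ _ (\sum_(j < n) (n.-1`! * B ^ n.-1 * B)%N%:Z)).
  apply: ler_sum => j _; rewrite normrM PoszM.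
  by apply: ler_pM => //; rewrite mxE; apply: cofactor_norm_le.
rewrite sumr_const card_ord; case: n i {Q e QB eB} => [[]//|n] i /=.
by rewrite -mulr_natl natz -PoszM factS expnS; lia.
Qed.

Section BasicSolution.
Variable R : realFieldType.

(** The ratio test of the simplex method: moving from [y] along [- v], the first coordinate to reach
    zero leaves the support, while coordinates that are already zero stay so. *)
Lemma reduce_support m n (A : 'M[R]_(m, n)) (y v : 'cV[R]_n) :
  (forall i, 0 <= y i 0) -> A *m v = 0 ->
  (forall i, y i 0 = 0 -> v i 0 = 0) -> (exists i, 0 < v i 0) ->
  exists z : 'cV[R]_n, [/\ forall i, 0 <= z i 0, A *m z = A *m y &
    ([set i | z i 0 != 0] \proper [set i | y i 0 != 0])%SET].
Proof.
move=> y0 Av yv [i0 vi0].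
pose t i := y i 0 / v i 0.
have [/= i vi tmin] := @arg_minP _ _ _ i0 (fun i => 0 < v i 0) t vi0.
have ti : 0 <= t i by rewrite divr_ge0 // ltW.
exists (y - t i *: v); split.
- move=> k; rewrite !mxE subr_ge0; case: (ltP 0 (v k 0)) => vk.
    by rewrite -ler_pdivlMr //; apply: tmin.
  by apply: le_trans (y0 k); apply: mulr_ge0_le0.
- by rewrite mulmxBr -scalemxAr Av scaler0 subr0.
- apply/properP; split.
    apply/fintype.subsetP => k; rewrite !inE !mxE; apply: contraNneq => yk.
    by rewrite yk yv // mulr0 subr0.
  exists i; rewrite !inE.
    by apply: contraTneq vi => /yv ->; rewrite ltxx.
  by rewrite negbK !mxE divfK ?subrr // gt_eqF.
Qed.

(** Induction on the size of the support: a nonzero kernel vector living on it, or its opposite, has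
    a positive entry and serves to shrink it. The last clause is linear independence of the columns
    of [A] on the support of [z]. *)
Lemma minimal_support_solution m n (A : 'M[R]_(m, n)) (y : 'cV[R]_n) :
  (forall i, 0 <= y i 0) ->
  exists z : 'cV[R]_n, [/\ forall i, 0 <= z i 0, A *m z = A *m y &
    forall v : 'cV[R]_n, A *m v = 0 -> (forall i, z i 0 = 0 -> v i 0 = 0) ->
      v = 0].
Proof.
have [k] := ubnP #|[set i | y i 0 != 0]%SET|.
elim: k y => // k IH y ky y0.
case: (pselect (exists v : 'cV[R]_n, [/\ A *m v = 0,
    (forall i, y i 0 = 0 -> v i 0 = 0) & v <> 0])) => [[v [Av yv v0]]|nov]; last first.
  exists y; split=> // v Av yv; apply: contrapT => v0.
  by apply: nov; exists v.
suff [z [z0 Az /proper_card zy]] : exists z : 'cV[R]_n,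
    [/\ forall i, 0 <= z i 0, A *m z = A *m y &
    ([set i | z i 0 != 0] \proper [set i | y i 0 != 0])%SET].
  have [|u [u0 Au uv]] := IH z _ z0; first exact: leq_trans zy _.
  by exists u; split=> //; rewrite Au.
case: (pselect (exists i, 0 < v i 0)) => [vi|nvi].
  exact: reduce_support yv vi.
apply: (@reduce_support _ _ _ _ (- v)) => //.
- by rewrite mulmxN Av oppr0.
- by move=> i /yv vi; rewrite mxE vi oppr0.
- apply: contrapT => nvi'; apply: v0; apply/colP => i; rewrite mxE.
  apply/eqP; rewrite eq_le; apply/andP; split; rewrite leNgt; apply/negP => vi.
    by apply: nvi; exists i.
  by apply: nvi'; exists i; rewrite mxE oppr_gt0.
Qed.

(** The columns on a minimal support are independent, so suitable rows form an invertible square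
    system [Q]. By Cramer's rule [\det Q] clears all denominators of the solution, and [d] is its
    absolute value. *)
Lemma basic_solution m n (A : 'M[int]_(m, n)) (e : 'cV[int]_m) (y : 'cV[R]_n)
    (B : nat) :
  (0 < B)%N -> (forall i j, `|A i j| <= B%:Z) -> (forall i, `|e i 0| <= B%:Z) ->
  (forall i, 0 <= y i 0) -> map_mx intr A *m y = map_mx intr e ->
  exists (mu : 'I_n -> nat) (d : nat),
    [/\ (0 < d)%N, forall k, \sum_i A k i * (mu i)%:Z = d%:Z * e k 0,
        (#|[pred i | 0 < mu i]| <= m)%N & forall i, (mu i <= m`! * B ^ m)%N].
Proof.
move=> B0 AB eB y0 Ay.
have [z [z0 Az zmin]] := minimal_support_solution (map_mx intr A) y0.
move: Az; rewrite Ay => Az.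
pose S := [set i | z i 0 != 0]%SET.
pose sel : 'I_#|S| -> 'I_n := enum_val.
(* [P] extends a vector on the support by zero; as a right factor it selects the columns of the
   support. *)
pose P T : 'M[T : pzRingType]_(n, #|S|) := colsub sel 1%:M.
have AP T (X : 'M[T : pzRingType]_(m, n)) : X *m P T = colsub sel X.
  by rewrite mulmx_colsub mulmx1.
have Psel (T : pzRingType) (u : 'cV[T]_#|S|) k : (P T *m u) (sel k) 0 = u k 0.
  rewrite mxE (bigD1 k) //= !mxE eqxx mul1r big1 ?addr0 // => l lk.
  by rewrite !mxE (inj_eq enum_val_inj) eq_sym (negPf lk) mul0r.
have PnS (T : pzRingType) (u : 'cV[T]_#|S|) i : i \notin S -> (P T *m u) i 0 = 0.
  move=> iS; rewrite mxE big1 // => l _; rewrite !mxE.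
  case: eqP => [il|]; last by rewrite mul0r.
  by move: iS; rewrite il enum_valP.
pose M := colsub sel (map_mx intr A : 'M[R]_(m, n)).
(* A kernel vector of [M], extended by zero, is a kernel vector of [A] on the support of [z], hence
   zero by minimality. *)
have Mfull : row_full M.
  rewrite /row_full -mxrank_tr; apply: inj_row_free => u uM.
  have Mu : M *m u^T = 0 by rewrite -[M]trmxK -trmx_mul uM trmx0.
  have Pu : P R *m u^T = 0.
    apply: zmin; first by rewrite mulmxA AP.
    by move=> i /eqP zi; apply: PnS; rewrite inE negbK.
  by apply/rowP => k; have := Psel R u^T k; rewrite Pu !mxE.
have zP : z = P R *m rowsub sel z.
  apply/colP => i; case: (boolP (i \in S)) => iS; last first.
    by rewrite PnS //; move: iS; rewrite inE negbK => /eqP.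
  by rewrite -(enum_rankK_in iS iS) Psel mxE.
pose f := fullrankfun Mfull.
pose Q := mxsub f sel A.
have QR : map_mx intr Q = rowsub f M.
  by rewrite map_mxsub; apply/matrixP => a b; rewrite !mxE.
have dQ : \det Q != 0.
  have := fullrowsub_unit Mfull; rewrite -/f -QR unitmxE unitfE det_map_mx.
  by rewrite intr_eq0.
pose a := \adj Q *m rowsub f e.
have aE : map_mx intr a = (\det Q)%:~R *: rowsub sel z.
  rewrite map_mxM map_mx_adj (map_mxsub _ e) -Az {1}zP mulmxA AP -mul_rowsub_mx -QR.
  by rewrite mulmxA mul_adj_mx det_map_mx mul_scalar_mx.
pose b := P int *m a.
have bE i : (b i 0)%:~R = (\det Q)%:~R * z i 0 :> R.
  case: (boolP (i \in S)) => iS; last first.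
    by rewrite PnS //; move: iS; rewrite inE negbK => /eqP ->; rewrite mulr0.
  rewrite -(enum_rankK_in iS iS) Psel; move/colP/(_ (enum_rank_in iS i)): aE.
  by rewrite !mxE.
(* [\det Q] may be negative; since [z] is nonnegative, absolute values change all signs together. *)
have absb i : (absz (b i 0))%:Z%:~R = (absz (\det Q))%:Z%:~R * z i 0 :> R.
  by rewrite !abszE !intr_norm bE normrM (ger0_norm (z0 i)).
have Sm : (#|S| <= m)%N by rewrite -(eqP Mfull) rank_leq_row.
exists (fun i => absz (b i 0)); exists (absz (\det Q)); split.
- by rewrite absz_gt0.
- move=> k; apply: (@intr_inj R); rewrite rmorph_sum rmorphM /=.
  under eq_bigr do rewrite rmorphM /= absb mulrCA.
  rewrite -mulr_sumr; congr (_ * _); move/colP/(_ k): Az; rewrite !mxE => <-.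
  by apply: eq_bigr => i _; rewrite mxE.
- apply: leq_trans Sm; apply: subset_leq_card; apply/fintype.subsetP => i.
  by rewrite inE absz_gt0; apply: contraR => iS; rewrite /b PnS.
- move=> i; have SB : ((#|S|)`! * B ^ #|S| <= m`! * B ^ m)%N.
    by rewrite leq_mul ?leq_pexp2l ?leq_fact.
  apply: leq_trans SB; case: (boolP (i \in S)) => iS; last by rewrite /b PnS.
  rewrite -(enum_rankK_in iS iS) -lez_nat abszE Psel.
  by apply: adj_mul_norm_le => *; rewrite !mxE.
Qed.

End BasicSolution.

(* Strict constraints are rescaled to [>= 1], so that a homogeneous system has
   the same positive directions as a system of equations with slack variables. *)
Lemma small_solution (R : realFieldType) (K J : finType) (c : K -> J -> int)
    (st : pred K) (B : nat) (x : J -> R) :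
  (0 < B)%N -> (forall k j, `|c k j| <= B%:Z) -> (forall j, 0 <= x j) ->
  (forall k, let s := \sum_j (c k j)%:~R * x j in
             if st k then 0 < s else 0 <= s) ->
  exists mu : J -> nat,
    [/\ forall k, let s := \sum_j c k j * (mu j)%:Z in
                  if st k then 0 < s else 0 <= s,
        (#|[pred j | 0 < mu j]| <= #|K|)%N &
        forall j, (mu j <= (#|K|)`! * B ^ #|K|)%N].
Proof.
move=> B0 cB x0 cx; set s := fun k => \sum_j (c k j)%:~R * x j in cx *.
have s0 k : 0 <= s k by have := cx k; case: (st k) => // /ltW.
(* The sum of the inverses is one scale that lifts every strict constraint to at least 1. *)
pose T := \sum_(k | st k) (s k)^-1.
have T0 : 0 <= T by apply: sumr_ge0 => k _; rewrite invr_ge0.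
have Ts k : st k -> 1 <= T * s k.
  move=> sk; have := cx k; rewrite sk => sk0.
  rewrite -ler_pdivrMr // mul1r /T (bigD1 k) //= lerDl.
  by apply: sumr_ge0 => l _; rewrite invr_ge0.
pose C : 'M[int]_(#|K|, #|J|) := \matrix_(k, j) c (enum_val k) (enum_val j).
(* The last [#|K|] columns belong to the slack variables. *)
pose A : 'M[int]_(#|K|, #|J| + #|K|) := row_mx C (- 1%:M).
pose e : 'cV[int]_#|K| := \col_k (st (enum_val k))%:R.
pose xc : 'cV[R]_#|J| := \col_j (T * x (enum_val j)).
pose y : 'cV[R]_(#|J| + #|K|) := col_mx xc (map_mx intr C *m xc - map_mx intr e).
have Cxc k : (map_mx intr C *m xc) k 0 = T * s (enum_val k).
  rewrite mxE /s mulr_sumr [RHS](reindex (@enum_val J J)) /=; last first.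
    by apply: onW_bij; apply: enum_val_bij.
  by apply: eq_bigr => j _; rewrite !mxE mulrCA.
have [|||||mu [d [d0 muE mus muB]]] := @basic_solution R _ _ A e y B.
- by [].
- move=> i j; rewrite mxE; case: split => l; rewrite !mxE ?cB //.
  by rewrite normrN; case: eqP => _ /=; lia.
- by move=> i; rewrite mxE; case: (st _) => /=; lia.
- move=> i; rewrite mxE; case: split => l; first by rewrite mxE mulr_ge0.
  rewrite mxE Cxc !mxE subr_ge0; case: (boolP (st _)) => [/Ts //|_] /=.
  by rewrite mulr0z mulr_ge0.
- rewrite map_row_mx mul_row_col map_mxN map_mx1 mulNmx mul1mx opprB addrC.
  by rewrite addrNK.
(* The slacks are dropped: by equation [k] the sum is a nonnegative slack, plus [d > 0] when the
   constraint is strict. *)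
exists (fun j => mu (lshift _ (enum_rank j))); split.
- move=> k; have := muE (enum_rank k); rewrite big_split_ord /=.
  set a := \sum_(i < #|J|) _; set b := \sum_(i < #|K|) _.
  have -> : \sum_j c k j * (mu (lshift #|K| (enum_rank j)))%:Z = a.
    rewrite [LHS](reindex (@enum_val J J)) /=; last first.
      by apply: onW_bij; apply: enum_val_bij.
    apply: eq_bigr => j _; rewrite enum_valK row_mxEl mxE enum_rankK.
    by [].
  have -> : b = - (mu (rshift #|J| (enum_rank k)))%:Z.
    rewrite /b (bigD1 (enum_rank k)) //= row_mxEr !mxE eqxx mulN1r big1 ?addr0 //.
    move=> l lk; rewrite row_mxEr !mxE eq_sym (negPf lk) oppr0 mul0r //.
  by rewrite mxE enum_rankK; case: (st k) => /=; lia.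
- pose g (j : J) : 'I_(#|J| + #|K|) := lshift #|K| (enum_rank j).
  have gI : injective g by move=> i j /lshift_inj /enum_rank_inj.
  apply: leq_trans mus; rewrite -[leqLHS](card_imset _ gI).
  apply: subset_leq_card; apply/fintype.subsetP => _ /imsetP [l ml ->].
  by move: ml; rewrite !inE.
- by move=> j; apply: muB.
Qed.

(** * Choquet expectations *)

(* The value on [U] of the measure concentrated on the focal set [V]: the belief
   function ([b = true]) tests [V `<=` U], its dual possibility measure
   ([b = false]) tests whether [V] meets [U]. *)
Definition meets W (b : bool) (V U : set W) : bool :=
  if b then `[< V `<=` U >] else `[< exists2 w, V w & U w >].

Definition is_extremum W (b : bool) (X : W -> int) (V : set W) (v : int) :=
  (exists2 w, V w & X w = v) /\
  (forall w, V w -> if b then v <= X w else X w <= v).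

(** An upper level set of [X] contains [V] iff the minimum on [V] exceeds the threshold, and meets
    [V] iff the maximum does. *)
Lemma meets_gt W b (X : W -> int) V v x :
  is_extremum b X V v -> meets b V [set w | x < X w] = (x < v).
Proof.
case=> [[w Vw <-]]; rewrite /meets; case: b => Xv; apply/idP/idP.
- by move/asboolP; apply.
- by move=> xw; apply/asboolP => u /Xv; apply: lt_le_trans.
- by case/asboolP => u /Xv Xu /= xu; apply: lt_le_trans Xu.
- by move=> xw; apply/asboolP; exists w.
Qed.

Lemma seq_extremum (b : bool) (s : seq int) : s != [::] ->
  exists2 v, v \in s & forall u, u \in s -> if b then v <= u else u <= v.
Proof.
elim: s => // a s IH _; case: (eqVneq s [::]) => [->|/IH [v vs vext]].
  by exists a; rewrite ?mem_head // => u; rewrite inE => /eqP ->; case: b {IH}.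
have [av|va] := boolP (if b then a <= v else v <= a).
  exists a; first exact: mem_head.
  move=> u; rewrite inE => /orP [/eqP ->|/vext]; first by case: (b).
  by case: (b) av; [apply: le_trans|move=> va uv; apply: le_trans va].
exists v; first by rewrite inE vs orbT.
move=> u; rewrite inE => /orP [/eqP ->|/vext //].
by case: (b) va => /negP; lia.
Qed.

Section Gambles.
Variables (W : Type) (pi : W -> nat -> bool).

Lemma gval_cons t g w :
  gval pi (t :: g) w = (if peval pi w t.2 then t.1 else 0) + gval pi g w.
Proof. by rewrite /gval big_cons. Qed.

Lemma gval_gcands g w : gval pi g w \in gcands g.
Proof.
elim: g => [|t g IH]; first by rewrite /gval big_nil inE.
rewrite gval_cons mem_cat; case: ifP => _; last by rewrite add0r IH.
by rewrite addrC (map_f (fun v => v + t.1)) ?orbT.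
Qed.

Lemma gval_grange g w : gval pi g w \in grange pi g.
Proof.
rewrite mem_sort mem_undup mem_filter gval_gcands andbT.
by apply/asboolP; exists w.
Qed.

Lemma grange_sorted g : sorted <%O (grange pi g).
Proof. by rewrite sort_lt_sorted undup_uniq. Qed.

(** A gamble takes finitely many values, so its extrema are attained even on an infinite set. *)
Lemma gval_extremum b g (V : set W) :
  (exists w, V w) -> exists v, is_extremum b (gval pi g) V v.
Proof.
case=> w Vw.
pose s := [seq v <- gcands g | `[< exists2 w, V w & gval pi g w = v >]].
have sP u : V u -> gval pi g u \in s.
  by move=> Vu; rewrite mem_filter gval_gcands andbT; apply/asboolP; exists u.
have [|v] := @seq_extremum b s; first by apply: contraTneq (sP _ Vw) => ->.
rewrite mem_filter => /andP [/asboolP vw _] vext.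
by exists v; split=> // u /sP /vext.
Qed.

End Gambles.

Lemma peval_agree W W' (pi : W -> nat -> bool) (pi' : W' -> nat -> bool) w w' p :
  {in patoms p, pi w =1 pi' w'} -> peval pi w p = peval pi' w' p.
Proof.
elim: p => [n|p IH|p IHp q IHq] /= H; first by apply: H; rewrite inE.
  by rewrite IH.
by rewrite IHp ?IHq // => n np; apply: H; rewrite mem_cat np ?orbT.
Qed.

Lemma gval_agree W W' (pi : W -> nat -> bool) (pi' : W' -> nat -> bool) w w' g :
  {in gatoms g, pi w =1 pi' w'} -> gval pi g w = gval pi' g w'.
Proof.
elim: g => [|t g IH] H; first by rewrite /gval !big_nil.
rewrite !gval_cons IH => [|n ng]; last first.
  by apply: H; rewrite /gatoms /= mem_cat ng orbT.
by rewrite (@peval_agree _ _ pi pi' w w') // => n nt; apply: H; rewrite mem_cat nt.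
Qed.

Section Choquet.
Variables (R : realType) (W : Type) (pi : W -> nat -> bool) (nu : set W -> R).
Variables (J : finType) (x : J -> R).

(** The increments counted for index [j] telescope from [a] up to [v j]; this needs [v j] to be one
    of the listed values unless it is at most [a]. *)
Lemma esum_mixture (X : W -> int) (v : J -> int) a xs :
  (forall c, nu [set w | c < X w] = \sum_j x j * (c < v j)%R%:R) ->
  path <%O a xs -> (forall j, (v j <= a) || (v j \in xs)) ->
  esum nu X (a :: xs) = \sum_j x j * (if a < v j then v j - a else 0)%:~R.
Proof.
move=> nuE; elim: xs a => [|c xs IH] a.
  move=> _ va /=; rewrite big1 // => j _; case: ltP; rewrite ?mulr0 //.
  by have := va j; rewrite in_nil orbF => /le_lt_trans H /H; rewrite ltxx.
move=> /andP [ac cxs] va.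
have cx u : u \in xs -> c < u.
  by move=> uxs; move: (order_path_min lt_trans cxs) => /allP; apply.
rewrite -/(esum nu X _) /= -/(esum nu X (c :: xs)) IH // => [|j]; last first.
  by have /orP [|] := va j; rewrite ?inE; [move=> /le_trans -> //; exact: ltW|
     case/orP => [/eqP ->|->]; rewrite ?lexx ?orbT].
rewrite nuE mulr_sumr -big_split /=; apply: eq_bigr => j _.
rewrite mulrCA -mulrDr; congr (_ * _).
have [jle|] := boolP (v j <= a); first by rewrite !ltNge jle (le_trans jle (ltW ac)) mulr0 addr0.
rewrite -ltNge => aj; have := va j; rewrite leNgt aj /= inE => /orP [/eqP vc|/cx cj].
  by rewrite vc ltxx mulr1 addr0.
by rewrite cj mulr1 -rmorphD /=; congr (_%:~R); lia.
Qed.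

(** The expectation is linear in the measure, and a measure concentrated on one focal set gives the
    extremum there. Only upper level sets enter, so the mixture formula is required on those
    alone. *)
Lemma expect_mixture g (V : J -> set W) b (v : J -> int) :
  \sum_j x j = 1 ->
  (forall j, is_extremum b (gval pi g) (V j) (v j)) ->
  (forall c, let U := [set w | c < gval pi g w] in
     nu U = \sum_j x j * (meets b (V j) U)%:R) ->
  expect pi nu g = \sum_j x j * (v j)%:~R.
Proof.
move=> x1 vext nuE.
have vr j : v j \in grange pi g.
  by have [[w _ <-] _] := vext j; apply: gval_grange.
have := grange_sorted pi g; rewrite /expect /Echoquet.
case: (grange pi g) vr => [|a xs] vr.
  by move=> _; rewrite big1 // => j; have := vr j.
move=> axs; rewrite (@esum_mixture _ v) //; last first.
- by move=> j; have := vr j; rewrite inE => /orP [/eqP ->|->]; rewrite ?lexx ?orbT.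
- by move=> c; rewrite nuE; apply: eq_bigr => j _; rewrite (meets_gt _ (vext j)).
have -> : a%:~R = \sum_j x j * a%:~R :> R by rewrite -mulr_suml x1 mul1r.
rewrite -big_split /=; apply: eq_bigr => j _.
rewrite -mulrDr -rmorphD /=; congr (_ * _%:~R).
case: ltP => [|ja]; first lia.
have := vr j; rewrite inE => /orP [/eqP ->|vj]; first by rewrite addr0.
have := allP (order_path_min lt_trans axs) _ vj; lia.
Qed.

End Choquet.

(** * Belief functions and possibility measures on finite quotients *)

(** Toggling an element [a] of [U] outside [B] pairs the sets of the interval with opposite
    signs. *)
Lemma sum_sign_interval (R : pzRingType) (T : finType) (B U : {set T}) :
  \sum_(V : {set T} | (B \subset V) && (V \subset U)) (-1) ^+ #|V|
  = (if B == U then (-1) ^+ #|U| else 0) :> R.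
Proof.
case: eqP => [->|/eqP BU].
  by rewrite (big_pred1 U) // => V; rewrite /= finset.eqEsubset andbC.
have [sBU|nBU] := boolP (B \subset U); last first.
  by apply: big_pred0 => V; apply: contraNF nBU => /andP [/fintype.subset_trans]; apply.
have /properP [_ [a aU aB]] : B \proper U by rewrite finset.properEneq BU.
rewrite (bigID (fun V : {set T} => a \in V)) /=.
rewrite (reindex_onto (fun V => a |: V)%SET (fun V => V :\ a)%SET) /=; last first.
  by move=> V /andP [_ aV]; rewrite finset.setD1K.
apply/eqP; rewrite addr_eq0 -sumrN; apply/eqP; apply: eq_big => V.
  rewrite finset.setU11 andbT finset.subUset finset.sub1set aU /=.
  have [aV|aV] := boolP (a \in V).
    rewrite andbF; apply/negbTE; rewrite negb_and orbC.
    by apply/orP; left; apply: contraTneq aV => <-; rewrite !inE eqxx.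
  rewrite finset.setU1K // eqxx !andbT; congr (_ && _).
  apply/idP/idP => [sB|/fintype.subset_trans]; last by apply; apply: finset.subsetUr.
  apply/fintype.subsetP => c cB; have := fintype.subsetP sB c cB.
  by rewrite !inE => /orP [/eqP ca|//]; move: aB; rewrite -ca cB.
move=> /andP [_ /eqP aV]; have {}aV : a \notin V by rewrite -aV !inE eqxx.
by rewrite cardsU1 aV exprS mulN1r.
Qed.

(** The interval sum from the empty set to [U], without its first term and with signs reversed. *)
Lemma sum_sign_nonempty (R : pzRingType) (T : finType) (U : {set T}) :
  \sum_(I : {set T} | (0 < #|I|)%N) (-1) ^+ #|I|.+1 * (I \subset U)%:R
  = (U != finset.set0)%:R :> R.
Proof.
have := @sum_sign_interval R T finset.set0 U.
rewrite (bigD1 finset.set0) ?finset.sub0set //= cards0 expr0.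
under eq_bigl do rewrite finset.sub0set /=.
have -> : \sum_(I : {set T} | (0 < #|I|)%N) (-1) ^+ #|I|.+1 * (I \subset U)%:R
    = - \sum_(I : {set T} | (I \subset U) && (I != finset.set0)) (-1) ^+ #|I| :> R.
  rewrite -sumrN [LHS]big_mkcond [RHS]big_mkcond; apply: eq_bigr => I _.
  rewrite card_gt0 andbC; case: (I != _) => //=.
  by case: (I \subset U); rewrite ?mulr0 // mulr1 exprS mulN1r.
rewrite eq_sym; case: eqP => [->|_]; rewrite ?cards0 ?expr0 => E.
  by move/eqP: E; rewrite -subr_eq0 addrAC subrr add0r => /eqP ->; rewrite oppr0.
by apply/eqP; rewrite eq_sym -subr_eq0 opprK E.
Qed.

Section Mobius.
Variables (R : comPzRingType) (T : finType) (beta : {set T} -> R).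

Definition mobius (V : {set T}) : R :=
  \sum_(B : {set T} | B \subset V) (-1) ^+ (#|V| + #|B|) * beta B.

Lemma mobiusK (U : {set T}) : \sum_(V : {set T} | V \subset U) mobius V = beta U.
Proof.
rewrite (exchange_big_dep predT) //=.
under eq_bigr => B _.
  under eq_bigr do rewrite exprD -mulrA.
  rewrite -mulr_suml; under eq_bigl do rewrite andbC.
  rewrite sum_sign_interval; over.
rewrite (bigD1 U) //= eqxx big1 ?addr0; last by move=> B /negPf ->; rewrite mul0r.
by rewrite mulrA -expr2 -exprM muln2 -signr_odd odd_double mul1r.
Qed.

(** Indexing by complements in [V] gives the inversion formula the shape of the inclusion-exclusion
    sum in [is_belief]. *)
Lemma mobiusE V :
  mobius V = \sum_(I : {set T} | I \subset V) (-1) ^+ #|I| * beta (V :\: I)%SET.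
Proof.
rewrite /mobius (reindex_onto (fun I => V :\: I)%SET (fun B => V :\: B)%SET) /=.
  apply: eq_big => I; first by rewrite finset.subsetDl /= finset.setDDr finset.setDv finset.set0U; apply/eqP/finset.setIidPr.
  rewrite finset.subsetDl /= finset.setDDr finset.setDv finset.set0U => /eqP/finset.setIidPr IV.
  congr (_ * _); rewrite cardsD (finset.setIidPr IV) -signr_odd -[RHS]signr_odd.
  by have := subset_leq_card IV => le; congr (_ ^+ _); lia.
by move=> B BV; rewrite finset.setDDr finset.setDv finset.set0U; apply/finset.setIidPr.
Qed.
End Mobius.

Section Decomposition.
Variables (R : realType) (W : Type).

(** Transport along an enumeration lets any finite type index the family, in particular the points
    of the quotient. *)
Lemma belief_fin (nu : set W -> R) (T : finType) (U : T -> set W) :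
  is_belief nu ->
  \sum_(I : {set T} | (0 < #|I|)%N)
     (-1) ^+ #|I|.+1 * nu [set w | forall t, t \in I -> U t w]
  <= nu [set w | exists t, U t w].
Proof.
case=> _ _ _ /(_ _ (fun i : 'I_#|T| => U (enum_val i))).
have -> : [set w | exists j : 'I_#|T|, U (enum_val j) w] = [set w | exists t, U t w].
  apply/seteqP; split=> w /= [t Ut]; first by exists (enum_val t).
  by exists (enum_rank t); rewrite enum_rankK.
rewrite (reindex (fun I : {set T} => [set enum_rank t | t in I]%SET)) /=; last first.
  apply: onW_bij; exists (fun I : {set 'I_#|T|} => [set enum_val i | i in I]%SET) => I.
    rewrite -imset_comp -[RHS]imset_id; apply: eq_imset => t /=; exact: enum_rankK.
  rewrite -imset_comp -[RHS]imset_id; apply: eq_imset => t /=; exact: enum_valK.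
under eq_bigl do rewrite (card_imset _ enum_rank_inj).
under eq_bigr do rewrite (card_imset _ enum_rank_inj).
congr (_ <= _); apply: eq_bigr => I _; congr (_ * nu _).
apply/seteqP; split=> w /= H t tI.
  by rewrite -(enum_rankK t); apply: H; apply: imset_f.
by case/imsetP: tI => u uI ->; rewrite enum_rankK; apply: H.
Qed.

Variables (T : finType) (h : W -> T).

(** The masses are the Moebius inverse. Nonnegativity at [V] is the belief inequality for the sets
    [V] minus [t] with [t] in [V]: intersecting them over [I] gives [V] minus [I]. Points outside
    [V] index empty sets, so only subsets [I] of [V] contribute. *)
Lemma belief_mass (nu : set W -> R) : is_belief nu ->
  exists m : {set T} -> R, [/\ m finset.set0 = 0, forall V, 0 <= m V &
    forall U : {set T}, nu [set w | h w \in U] = \sum_V m V * (V \subset U)%:R].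
Proof.
move=> nub; pose beta (U : {set T}) := nu [set w | h w \in U].
have [nu0 _ nu01 _] := nub.
have beta0 : beta finset.set0 = 0.
  by rewrite /beta -nu0; congr nu; apply/seteqP; split=> w //=; rewrite inE.
exists (mobius beta); split.
- rewrite /mobius (big_pred1 finset.set0) ?cards0 ?beta0 ?mulr0 //.
  by move=> B; rewrite finset.subset0.
- move=> V; pose U t := [set w | (t \in V) && (h w \in V :\ t)%SET].
  have := belief_fin U nub.
  (* The union is all of [V] as soon as [V] has two points, and is empty otherwise. *)
  have UV : nu [set w | exists t, U t w] <= beta V.
    have [[t [u [tV uV tu]]]|nV] := pselect (exists t u, [/\ t \in V, u \in V & t != u]).
      rewrite le_eqVlt; apply/orP; left; apply/eqP; congr nu; apply/seteqP; split=> w /=.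
        by case=> s /andP [_]; rewrite inE => /andP [].
      move=> wV; case: (eqVneq (h w) t) => [wt|wt].
        by exists u; rewrite /U /= uV !inE wV wt tu.
      by exists t; rewrite /U /= tV !inE wV wt.
    have -> : [set w | exists t, U t w] = set0.
      apply/seteqP; split=> w //= [t /andP [tV]]; rewrite !inE => /andP [wt wV].
      by apply: nV; exists t; exists (h w); rewrite tV wV eq_sym wt.
    by rewrite nu0; have /andP [] := nu01 [set w | h w \in V].
  move=> /le_trans /(_ UV); rewrite -subr_ge0; congr (0 <= _).
  rewrite mobiusE [RHS](bigD1 finset.set0) ?finset.sub0set //= cards0 expr0 mul1r finset.setD0.
  congr (_ + _); rewrite -sumrN [LHS]big_mkcond [RHS]big_mkcond.
  apply: eq_bigr => I _; rewrite card_gt0 [in RHS]andbC; case: (altP eqP) => //= I0.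
  case: (boolP (I \subset V)) => IV; last first.
    have [t tI tV] := subsetPn IV.
    suff -> : [set w | forall t, t \in I -> U t w] = set0 by rewrite nu0 mulr0 oppr0.
    by apply/seteqP; split=> w //= /(_ t tI); rewrite /U /= (negPf tV).
  rewrite exprS mulN1r mulNr opprK; congr (_ * nu _); apply/seteqP; split=> w /=.
    have /finset.set0Pn [t tI] := I0.
    move=> H; have /andP [_] := H t tI; rewrite !inE => /andP [_ ->].
    rewrite andbT; apply/negP => wI; have /andP [_] := H _ wI.
    by rewrite !inE eqxx.
  rewrite inE => /andP [wI wV] t tI; rewrite /U /= (fintype.subsetP IV) //= !inE wV andbT.
  by apply: contraNneq wI => ->.
- move=> U; rewrite -/(beta U) -[LHS]mobiusK big_mkcond; apply: eq_bigr => V _.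
  by case: (V \subset U); rewrite ?mulr1 ?mulr0.
Qed.

Lemma possibility_mono (nu : set W -> R) U V :
  is_possibility nu -> U `<=` V -> nu U <= nu V.
Proof. by case=> _ _ nuU /setUidPr <-; rewrite nuU le_max lexx. Qed.

Lemma possibility_le (nu : set W -> R) (s : seq T) c : is_possibility nu ->
  0 <= c -> (forall t, t \in s -> nu [set w | h w = t] <= c) ->
  nu [set w | h w \in s] <= c.
Proof.
move=> [nu0 _ nuU] c0; elim: s => [|t s IH] sc.
  by rewrite (_ : [set w | _] = set0) ?nu0 //; apply/seteqP; split.
have -> : [set w | h w \in t :: s] = [set w | h w = t] `|` [set w | h w \in s].
  by apply/seteqP; split=> w /=; rewrite inE; [case/orP=> [/eqP|]; tauto|
     case=> [->|->]; rewrite ?eqxx ?orbT].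
rewrite nuU ge_max sc ?mem_head // IH // => u us.
by apply: sc; rewrite inE us orbT.
Qed.

(* Listing the points in order of decreasing possibility, the chain consists
   of the initial segments and the weights are the successive differences. *)
Lemma possibility_chain (nu : set W -> R) : is_possibility nu ->
  exists (n : nat) (V : 'I_n -> {set T}) (x : 'I_n -> R),
  [/\ forall i, 0 <= x i, forall i, V i != finset.set0,
      forall i j : 'I_n, (i <= j)%N -> V i \subset V j &
      forall U : {set T}, nu [set w | h w \in U]
        = \sum_i x i * (~~ [disjoint V i & U])%:R].
Proof.
move=> nup; have [nu0 _ nuU] := nup.
pose q t := nu [set w | h w = t].
pose s := sort (fun t u => q u <= q t) (enum T).
(* The default 0 past the end makes the last weight the smallest possibility itself. *)
pose p i := nth 0 (map q s) i.
have nu_ge0 U : 0 <= nu U by rewrite -nu0 possibility_mono.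
have ms t : t \in s by rewrite mem_sort mem_enum.
have srt : sorted (fun t u => q u <= q t) s by apply: sort_sorted => t u; apply: le_total.
have p_ge0 i : 0 <= p i.
  rewrite /p; case: (ltnP i (size s)) => [lt|ge].
    by case: (s) lt => // t0 s' lt; rewrite (nth_map t0) //; apply: nu_ge0.
  by rewrite nth_default // size_map.
have p_anti i j : (i <= j)%N -> p j <= p i.
  move=> ij; case: (ltnP j (size s)) => [lt|ge]; last first.
    by rewrite {1}/p nth_default ?size_map.
  rewrite /p; case: (s) lt srt => // t0 s' lt srt.
  rewrite !(nth_map t0) //; last exact: leq_ltn_trans lt.
  have qtr : transitive (fun t u => q u <= q t).
    by move=> a b c ab bc; apply: le_trans ab.
  have qrefl : reflexive (fun t u => q u <= q t) by move=> a; apply: lexx.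
  apply: (@sorted_leq_nth _ _ qtr qrefl t0 _ srt) => //; rewrite inE //.
  exact: leq_ltn_trans lt.
exists (size s); exists (fun i => [set t in take i.+1 s]%SET).
exists (fun i => p i - p i.+1).
split.
- by move=> i; rewrite subr_ge0 p_anti.
- move=> [i /=]; case: (s) => // t s' _; apply/finset.set0Pn; exists t.
  by rewrite inE mem_head.
- move=> i j ij; apply/fintype.subsetP => t; rewrite !inE.
  have -> : take i.+1 s = take i.+1 (take j.+1 s) by rewrite take_takel.
  exact: mem_take.
(* The first listed point of [U] has the largest possibility in [U], and exactly the segments from
   [k] on meet [U]; their weights telescope to [p k]. For empty [U], [k] is the length and [p k] is
   the default 0. *)
move=> U; pose k := find (mem U) s.
have ks : (k <= size s)%N by apply: find_size.
have -> : nu [set w | h w \in U] = p k.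
  case: (ltnP k (size s)) => [lt|ge]; last first.
    rewrite /p nth_default ?size_map // -nu0; congr nu; apply/seteqP; split=> w //=.
    move=> wU; move: ge; rewrite leqNgt -has_find => /hasPn /(_ _ (ms (h w))).
    by rewrite /= wU.
  have t0 : T by case: (s) lt.
  apply/eqP; rewrite eq_le; apply/andP; split.
    have -> : [set w | h w \in U] = [set w | h w \in enum U].
      by apply/seteqP; split=> w /=; rewrite mem_enum.
    apply: possibility_le => // t; rewrite mem_enum => tU.
    rewrite -/(q t); have -> : q t = p (index t s) by rewrite /p (nth_map t0) ?index_mem // nth_index.
    apply: p_anti; rewrite leqNgt; apply/negP => /(before_find t0).
    by rewrite nth_index //= tU.
  rewrite /p (nth_map t0) //; apply: possibility_mono => // w /= ->.
  by apply: (nth_find t0); rewrite has_find.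
have kE i : (i < size s)%N -> ~~ [disjoint [set t in take i.+1 s]%SET & U] = (k <= i)%N.
  move=> lt; rewrite -ltnS -has_take_leq //.
  apply/pred0Pn/hasP => [[t /andP []]|[t tt tU]].
    by rewrite /= inE => tt tU; exists t.
  by exists t; rewrite /= inE tt.
under eq_bigr => i _ do rewrite kE //.
rewrite -(big_mkord predT (fun i => (p i - p i.+1) * (k <= i)%N%:R)).
rewrite (@big_cat_nat _ _ _ k) //= big_nat_cond big1 ?add0r; last first.
  by move=> i /andP [/andP [_ ik] _]; rewrite leqNgt ik mulr0.
rewrite big_nat_cond (eq_bigr (fun i => - (p i.+1 - p i))); last first.
  by move=> i /andP [/andP [ki _] _]; rewrite ki mulr1 opprB.
rewrite -big_nat_cond sumrN telescope_sumr // opprB.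
by rewrite [X in _ - X]/p nth_default ?size_map ?subr0.
Qed.

End Decomposition.

(** * Mixtures of focal sets *)

Section Mixture.
Variables (R : realType) (W : Type) (J : finType) (x : J -> R) (V : J -> set W).

Definition mixture b (U : set W) : R := \sum_j x j * (meets b (V j) U)%:R.

Hypotheses (x_ge0 : forall j, 0 <= x j) (x_sum : \sum_j x j = 1).
Hypothesis V_nonempty : forall j, exists w, V j w.

Lemma mixture0 b : mixture b set0 = 0.
Proof.
rewrite /mixture big1 // => j _; have [w Vw] := V_nonempty j.
suff -> : meets b (V j) set0 = false by rewrite mulr0.
by apply/negP; rewrite /meets; case: b => /asboolP; [move=> /(_ _ Vw)|case].
Qed.

Lemma mixtureT b : mixture b setT = 1.
Proof.
rewrite -x_sum; apply: eq_bigr => j _; have [w Vw] := V_nonempty j.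
suff -> : meets b (V j) setT by rewrite mulr1.
by rewrite /meets; case: b; apply/asboolP => //; exists w.
Qed.

(** Checked one focal set at a time: its inclusion-exclusion sum is 1 if some [U i] contains it and
    0 otherwise, and in the first case the union contains it too. *)
Lemma mixture_belief : is_belief (mixture true).
Proof.
split; [exact: mixture0|exact: mixtureT| |] => [U|n U].
  apply/andP; split; first by apply: sumr_ge0 => j _; rewrite mulr_ge0.
  by rewrite -x_sum; apply: ler_sum => j _; case: meets; rewrite ?mulr1 ?mulr0.
under eq_bigr do rewrite mulr_sumr.
rewrite exchange_big /=; apply: ler_sum => j _.
pose S := [set i | meets true (V j) (U i)]%SET.
have -> : \sum_(I : {set 'I_n} | (0 < #|I|)%N) (-1) ^+ #|I|.+1 *
    (x j * (meets true (V j) [set w | forall i, i \in I -> U i w])%:R)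
  = x j * (S != finset.set0)%:R.
  rewrite -sum_sign_nonempty mulr_sumr; apply: eq_bigr => I _.
  rewrite mulrCA; congr (_ * (_ * _%:R)); congr nat_of_bool.
  apply/asboolP/fintype.subsetP => [H i iI|H w Vw i iI].
    by rewrite inE; apply/asboolP => w /H; apply.
  by have := H i iI; rewrite inE => /asboolP; apply.
apply: ler_wpM2l => //; rewrite ler_nat; case: (boolP (S == _)) => //=.
case/finset.set0Pn => i; rewrite inE => /asboolP VU.
by rewrite lt0b; apply/asboolP => w /VU Uw; exists i.
Qed.

(** The indices whose focal set meets a given set are upward closed for [le]. Two upward closed sets
    of a total relation are nested, so the sum for a union is the larger of the two sums. *)
Lemma mixture_possibility (le : rel J) : total le ->
  (forall i j, le i j -> V i `<=` V j) -> is_possibility (mixture false).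
Proof.
move=> le_total leV; split; [exact: mixture0|exact: mixtureT|] => U1 U2.
have meetsU j : meets false (V j) (U1 `|` U2)
    = meets false (V j) U1 || meets false (V j) U2.
  apply/asboolP/orP => [[w Vw [Uw|Uw]]|[/asboolP|/asboolP] [w Vw Uw]].
  - by left; apply/asboolP; exists w.
  - by right; apply/asboolP; exists w.
  - by exists w => //; left.
  - by exists w => //; right.
have mono U i j : le i j -> meets false (V i) U -> meets false (V j) U.
  move=> /leV ij /asboolP [w Vw Uw]; apply/asboolP; exists w => //; exact: ij.
have mixture_le A B : (forall j, meets false (V j) A ==> meets false (V j) B) ->
    mixture false A <= mixture false B.
  move=> AB; apply: ler_sum => j _; apply: ler_wpM2l => //; rewrite ler_nat.
  by have := AB j; do 2 case: meets.
have [/forallP sub|] := boolP [forall j, meets false (V j) U1 ==> meets false (V j) U2].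
  rewrite (max_idPr (mixture_le _ _ sub)); apply: eq_bigr => j _.
  by rewrite meetsU; have := sub j; do 2 case: meets.
rewrite negb_forall => /existsP [i]; rewrite negb_imply => /andP [i1 i2].
have sub j : meets false (V j) U2 ==> meets false (V j) U1.
  apply/implyP => j2; have /orP [/mono|/mono] := le_total i j; first exact.
  by move/(_ _ j2); rewrite (negPf i2).
rewrite (max_idPl (mixture_le _ _ sub)); apply: eq_bigr => j _.
by rewrite meetsU; have := sub j; do 2 case: meets.
Qed.

End Mixture.

Section MixtureMass.
Variables (R : realType) (W : finType) (J : finType) (x : J -> R).
Variable V : J -> {set W}.
Let VS j : set W := [set w | w \in V j].

Definition mixture_mass (U : {set W}) : R := \sum_(j | V j == U) x j.

Lemma mixture_is_mass : (forall j, V j != finset.set0) ->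
  is_mass (mixture x VS true) mixture_mass.
Proof.
move=> V0; split.
  by rewrite /mixture_mass big_pred0 // => j; apply/negbTE.
move=> U; rewrite /mixture_mass (exchange_big_dep predT) //=; apply: eq_bigr => j _.
have -> : meets true (VS j) [set w | w \in U] = (V j \subset U).
  by apply/asboolP/fintype.subsetP.
case: (boolP (V j \subset U)) => jU; rewrite ?mulr0 ?mulr1.
  rewrite (big_pred1 (V j)) // => B.
  by apply/andP/eqP => [[_ /eqP]|->].
by rewrite big_pred0 // => B; apply/negP => /andP [BU /eqP jB]; rewrite jB BU in jU.
Qed.

(** A focal set lies in [U] iff it misses the complement, so both kinds of mixture share one mass
    function. *)
Lemma poss_dual_mixture : \sum_j x j = 1 ->
  poss_dual (mixture x VS false) = mixture x VS true.
Proof.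
move=> x1; apply/funext => U; rewrite /poss_dual -x1 -sumrB; apply: eq_bigr => j _.
have -> : meets true (VS j) U = ~~ meets false (VS j) (~` U).
  apply/asboolP/negP => [VU /asboolP [w /VU Uw]|nVU w Vw]; first exact.
  by apply: contrapT => nU; apply: nVU; apply/asboolP; exists w.
by case: meets; rewrite /= ?mulr0 ?mulr1 ?subrr ?subr0.
Qed.

Lemma mixture_mass_gt0 U : injective V -> 0 < mixture_mass U ->
  exists2 j, V j = U & mixture_mass U = x j.
Proof.
move=> VI; have [[j /eqP jU] _|nU] := pselect (exists j, V j == U).
  by exists j => //; rewrite /mixture_mass (big_pred1 j) // => i; rewrite -jU (inj_eq VI).
by rewrite /mixture_mass big_pred0 ?ltxx // => j; apply/negP => jU; apply: nU; exists j.
Qed.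

Lemma mixture_mass_card : injective V ->
  (#|[pred U | (0 < mixture_mass U)%R]| <= #|J|)%N.
Proof.
move=> VI; rewrite -cardsT -(card_imset _ VI); apply: subset_leq_card.
apply/fintype.subsetP => U; rewrite inE => /(mixture_mass_gt0 VI) [j <- _].
exact: imset_f.
Qed.

End MixtureMass.

(** * Inequalities and gambles occurring in a formula *)

HB.instance Definition _ := gen_eqMixin pform.

Fixpoint ineqs (f : fml) : seq (seq (int * gamble) * int) :=
  match f with
  | Ineq ts b => [:: (ts, b)]
  | FNot g => ineqs g
  | FAnd g h => ineqs g ++ ineqs h
  end.

Definition gambles (f : fml) : seq gamble :=
  flatten [seq [seq t.2 | t <- q.1] | q <- ineqs f].

Lemma gambles_mem f q t : q \in ineqs f -> t \in q.1 -> t.2 \in gambles f.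
Proof.
by move=> qf tq; apply/flattenP; exists [seq t.2 | t <- q.1]; apply: map_f.
Qed.

(** Strictness leaves room for one more constraint, the positivity of the total weight. *)
Lemma ineqs_size f : (size (ineqs f) < fsize f)%N.
Proof.
elim: f => [ts b|f IH|f IHf g IHg] /=; rewrite ?size_cat; lia.
Qed.

(** Strictness leaves room for one extra world per focal set, which keeps the sets nonempty when no
    gamble occurs. *)
Lemma gambles_size f : (size (gambles f) < fsize f)%N.
Proof.
rewrite /gambles; elim: f => [ts b|f IH|f IHf g IHg] /=; last 2 first.
- lia.
- rewrite map_cat flatten_cat size_cat; lia.
rewrite cats0 size_map; suff : (size ts <= \sum_(t <- ts) (2 + gsize t.2))%N by lia.
by rewrite -sum1_size; apply: leq_sum => t _; lia.
Qed.

Lemma ineqs_bounds f q : q \in ineqs f ->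
  (fsize (Ineq q.1 q.2) <= fsize f)%N /\ (fmaxlen (Ineq q.1 q.2) <= fmaxlen f)%N.
Proof.
elim: f => [ts b|f IH|f IHf g IHg].
- by rewrite inE => /eqP ->.
- by move=> /IH /=; lia.
- by rewrite mem_cat => /orP [/IHf|/IHg] [] /= A B; split; lia.
Qed.

Lemma gambles_atoms f g : g \in gambles f -> {subset gatoms g <= fatoms f}.
Proof.
rewrite /gambles; elim: f => [ts b|f IH|f1 IH1 f2 IH2] //=.
  rewrite cats0 => /mapP [t tts ->] n nt.
  by apply/flattenP; exists (gatoms t.2) => //; apply: (map_f (fun t => gatoms t.2)).
rewrite map_cat flatten_cat mem_cat => /orP [/IH1|/IH2] H n /H nf;
  by rewrite mem_cat nf ?orbT.
Qed.

Lemma sat_agree (R : realType) W W' (pi : W -> nat -> bool)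
    (pi' : W' -> nat -> bool) (nu : set W -> R) (nu' : set W' -> R) f :
  (forall q, q \in ineqs f -> (q.2%:~R <= \sum_(t <- q.1) t.1%:~R * expect pi nu t.2)
     = (q.2%:~R <= \sum_(t <- q.1) t.1%:~R * expect pi' nu' t.2)) ->
  sat pi nu f <-> sat pi' nu' f.
Proof.
elim: f => [ts b|f IH|f IHf g IHg] /= H.
- by rewrite (H (ts, b)) // inE.
- by rewrite IH.
- by rewrite IHf ?IHg // => q qf; apply: H; rewrite mem_cat qf ?orbT.
Qed.

(** * Bit lengths and bounds on coefficients *)

Lemma expn2_pow k : (2 ^ k)%N = Nat.pow 2 k.
Proof. by elim: k => // k IH; rewrite expnS IH /=; lia. Qed.

Lemma bitlen_gt z : (absz z < 2 ^ bitlen z)%N.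
Proof.
rewrite expn2_pow /bitlen; case: (posnP (absz z)) => [->|z0]; first by [].
by have := PeanoNat.Nat.log2_spec (absz z); lia.
Qed.

Lemma log2_expn k : Nat.log2 (2 ^ k)%N = k.
Proof.
by rewrite expn2_pow PeanoNat.Nat.log2_pow2 //; lia.
Qed.

Lemma bitlen_le z k : (absz z <= 2 ^ k)%N -> (bitlen z <= k.+1)%N.
Proof.
move=> /ssrnat.leP zk; rewrite /bitlen ltnS -(log2_expn k); apply/ssrnat.leP.
exact: PeanoNat.Nat.log2_le_mono.
Qed.

(** Reduction to lowest terms can only shrink the denominator, and the numerator stays at most the
    denominator. *)
Lemma ratsize_frac_le (a M k : nat) : (a <= M)%N -> (0 < M)%N -> (M <= 2 ^ k)%N ->
  (ratsize (a%:Q / M%:Q) <= k.+1.*2)%N.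
Proof.
move=> aM M0 Mk; rewrite /ratsize -addnn.
have : (absz a <= absz M)%N by []; have : absz M != 0%N by rewrite /= -lt0n.
have : (absz M <= 2 ^ k)%N by [].
case: (divqP a M) => [//|c q c0]; rewrite !abszM => dk _ nd.
have c1 : (0 < absz c)%N by rewrite absz_gt0.
have dk' : (absz (denq q) <= 2 ^ k)%N by apply: leq_trans dk; rewrite leq_pmull.
apply: leq_add; apply: bitlen_le => //.
by apply: (leq_trans _ dk'); move: nd; rewrite leq_pmul2l.
Qed.

Lemma gval_norm_le W (pi : W -> nat -> bool) g w l : (gmaxlen g <= l)%N ->
  `|gval pi g w| <= (size g * 2 ^ l)%N%:Z.
Proof.
rewrite /gmaxlen; elim: g => [|t g IH]; first by rewrite /gval !big_nil normr0.
rewrite gval_cons big_cons geq_max => /andP [tl /IH {}IH].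
have : (absz t.1 < 2 ^ l)%N.
  by apply: leq_trans (bitlen_gt _) _; rewrite leq_exp2l.
by rewrite /= mulSn; case: peval; lia.
Qed.

Lemma ineq_coef_le f q (v : gamble -> int) : q \in ineqs f ->
  (forall g, (gmaxlen g <= fmaxlen f)%N ->
     `|v g| <= (size g * 2 ^ fmaxlen f)%N%:Z) ->
  `|\sum_(t <- q.1) t.1 * v t.2 - q.2| <= (fsize f * 2 ^ (fmaxlen f).*2)%N%:Z.
Proof.
move=> /ineqs_bounds [/=]; set l := fmaxlen f; case: q => ts b /= szf.
rewrite geq_max => /andP [bl tsl] vl.
have b2 : (absz b <= 2 ^ l.*2)%N.
  apply: leq_trans (ltnW (bitlen_gt _)) _; rewrite leq_exp2l //.
  by apply: leq_trans bl _; rewrite -addnn leq_addr.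
suff : `|\sum_(t <- ts) t.1 * v t.2|
    <= ((\sum_(t <- ts) (2 + gsize t.2)) * 2 ^ l.*2)%N%:Z.
  move: szf; set S := (\sum_(t <- ts) _)%N => szf.
  (* The extra 1 accounts for the constant [b] and is paid for by the symbols [>=] and [b]. *)
  have : ((S + 1) * 2 ^ l.*2 <= fsize f * 2 ^ l.*2)%N.
    by rewrite leq_mul2r; apply/orP; right; lia.
  rewrite mulnDl mul1n -lez_nat => szl SP; apply: le_trans szl.
  by apply: le_trans (ler_normB _ _) _; rewrite PoszD lerD // -abszE lez_nat.
elim: ts tsl {szf} => [|t ts IH]; first by rewrite !big_nil.
rewrite !big_cons !geq_max => /andP [/andP [tl gl] /IH {}IH].
have tt : (absz t.1 <= 2 ^ l)%N.
  by apply: leq_trans (ltnW (bitlen_gt _)) _; rewrite leq_exp2l.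
have gg : (size t.2 <= gsize t.2)%N.
  rewrite /gsize -{1}sum1_size; apply: leq_trans (leq_addr _ _).
  by apply: leq_sum => i _; lia.
suff tv : `|t.1 * v t.2| <= ((2 + gsize t.2) * 2 ^ l.*2)%N%:Z.
  by rewrite mulnDl PoszD; apply: le_trans (ler_normD _ _) (lerD tv IH).
rewrite normrM -addnn expnD mulnA mulnC PoszM.
apply: ler_pM => //; apply: le_trans (vl _ gl) _.
by rewrite lez_nat leq_mul2r (leq_trans gg) ?orbT // leq_addl.
Qed.

(** * Small models *)

Lemma fact_le_expn n m : (n <= m)%N -> (n`! <= m ^ n)%N.
Proof.
elim: n => // n IH nm; rewrite factS expnS leq_mul // IH //; exact: ltnW.
Qed.

Lemma fsize_gt1 f : (1 < fsize f)%N.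
Proof. by elim: f => [ts b|f|f ? g ?] /=; lia. Qed.

Lemma fmaxlen_gt0 f : (0 < fmaxlen f)%N.
Proof. by elim: f => [ts b|f|f fl g gl] /=; rewrite ?leq_max ?fl. Qed.

Definition size_bound f :=
  (fsize f * fmaxlen f + fsize f * Nat.log2 (fsize f))%N.

(** With [L = log2 F >= 1] one has [F <= 2 ^ (2 L)], so the exponent is at most
    [2 L + 2 L F + (2 L + 2 l) F], which is below six times the bound. *)
Lemma solution_sum_le f N : (N <= fsize f)%N ->
  (N * (N`! * (fsize f * 2 ^ (fmaxlen f).*2) ^ N) <= 2 ^ (6 * size_bound f))%N.
Proof.
set F := fsize f; set l := fmaxlen f; move=> NF.
have F1 : (1 < F)%N by apply: fsize_gt1.
have L0 : (0 < Nat.log2 F)%N by have := PeanoNat.Nat.log2_pos F; lia.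
have F2 : (F <= 2 ^ (Nat.log2 F).*2)%N.
  apply: (@leq_trans (2 ^ (Nat.log2 F).+1)); last by rewrite leq_exp2l //; lia.
  by have := bitlen_gt F; rewrite /bitlen /= => /ltnW.
apply: (@leq_trans (F * (F ^ F * (F * 2 ^ l.*2) ^ F))).
  rewrite !leq_mul //; first by apply: leq_trans (fact_le_expn NF) _; rewrite leq_pexp2l //; lia.
  by rewrite leq_pexp2l // muln_gt0 expn_gt0; lia.
apply: (@leq_trans (2 ^ (Nat.log2 F).*2 * ((2 ^ (Nat.log2 F).*2) ^ F *
    (2 ^ (Nat.log2 F).*2 * 2 ^ l.*2) ^ F))).
  by rewrite !leq_mul // leq_exp2r ?leq_mul //; lia.
rewrite -!expnD -!expnM -!expnD leq_exp2l // /size_bound -/F -/l; nia.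
Qed.

Section SmallMixture.
Variables (R : realType) (f : fml) (b : bool) (W : Type) (nu : set W -> R).
Variables (pi : W -> nat -> bool) (J : finType) (le : rel J).
Variables (x : J -> R) (V : J -> set W).
Hypotheses (le_refl : reflexive le) (leV : forall i j, le i j -> V i `<=` V j).
Hypotheses (x_ge0 : forall j, 0 <= x j) (x_sum : \sum_j x j = 1).
Hypothesis V_nonempty : forall j, exists w, V j w.
Hypothesis nuE : forall g c, g \in gambles f ->
  let U := [set w | c < gval pi g w] in nu U = mixture x V b U.
Hypothesis nu_sat : sat pi nu f.

(* The new worlds are witnesses of the extrema of the gambles of [f] on the sets
   [V j] of positive weight, one copy for each set; [le] is equality for belief
   functions and the order of the chain for possibility measures. *)
Lemma small_mixture :
  exists (A : {pred J}) (y : {j | j \in A} -> rat)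
    (pi' : {j | j \in A} * 'I_(size (gambles f)).+1 -> nat -> bool),
  [/\ (0 < #|A| <= fsize f)%N,
      (forall j, 0 <= y j) /\ \sum_j y j = 1,
      forall j, (ratsize (y j) <= 14 * size_bound f)%N,
      sat pi' (mixture (fun j => ratr (y j) : R)
        (fun j => [set w | le (val w.1) (val j)]) b) f &
      forall w p, p \notin fatoms f -> pi' w p = false].
Proof.
have /choice [wit witP] (p : J * gamble) : exists w,
    V p.1 w /\ is_extremum b (gval pi p.2) (V p.1) (gval pi p.2 w).
  have [v vext] := gval_extremum pi b p.2 (V_nonempty p.1).
  by have [[w Vw wv] _] := vext; exists w; rewrite wv.
pose v j g := gval pi g (wit (j, g)).
have vext j g : is_extremum b (gval pi g) (V j) (v j g) by have [] := witP (j, g).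
have expE g : g \in gambles f -> expect pi nu g = \sum_j x j * (v j g)%:~R.
  by move=> gf; apply: (@expect_mixture _ _ _ _ _ _ _ V b) => // c; apply: nuE.
(* As the weights sum to 1, the constant can be subtracted from every coefficient, which makes the
   inequality homogeneous. *)
pose cc q j := \sum_(t <- q.1) t.1 * v j t.2 - q.2.
have ccE (z : J -> R) q : \sum_j z j = 1 ->
    \sum_j (cc q j)%:~R * z j
    = \sum_(t <- q.1) t.1%:~R * (\sum_j z j * (v j t.2)%:~R) - q.2%:~R.
  move=> z1.
  under eq_bigr do rewrite /cc rmorphB /= mulrBl rmorph_sum /= mulr_suml.
  rewrite sumrB -mulr_sumr z1 mulr1 exchange_big /=; congr (_ - _).
  apply: eq_bigr => t _; rewrite mulr_sumr; apply: eq_bigr => j _.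
  by rewrite rmorphM /= -mulrA (mulrC (z j)).
pose N := size (ineqs f).
pose q (i : 'I_N) := tnth (in_tuple (ineqs f)) i.
have qf i : q i \in ineqs f by apply: mem_tnth.
pose ok i := (q i).2%:~R <= \sum_(t <- (q i).1) t.1%:~R * expect pi nu t.2.
(* [None] stands for positivity of the total weight; inequalities that fail are negated and become
   strict. *)
pose c (k : option 'I_N) j : int :=
  if k is Some i then (if ok i then cc (q i) j else - cc (q i) j) else 1.
pose st (k : option 'I_N) := if k is Some i then ~~ ok i else true.
pose B := (fsize f * 2 ^ (fmaxlen f).*2)%N.
have B0 : (0 < B)%N by rewrite muln_gt0 expn_gt0; have := fsize_gt1 f; lia.
have ccB i j : `|cc (q i) j| <= B%:Z.
  by apply: ineq_coef_le (qf i) _ => g; apply: gval_norm_le.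
have [||mu [muc mus muB]] := @small_solution R _ J c st B x B0 _ x_ge0.
- by move=> [i|] j /=; [case: ifP; rewrite ?normrN|rewrite normr1; lia].
- case=> [i|] /=; last first.
    by under eq_bigr do rewrite mul1r; rewrite x_sum ltr01.
  have E : \sum_j (cc (q i) j)%:~R * x j =
      \sum_(t <- (q i).1) t.1%:~R * expect pi nu t.2 - (q i).2%:~R.
    rewrite ccE //; congr (_ - _); apply: eq_big_seq => t tq.
    by rewrite expE // (gambles_mem (qf i)).
  have [oki|nok] := boolP (ok i); first by rewrite E subr_ge0.
  under eq_bigr do rewrite rmorphN mulNr.
  by rewrite sumrN E oppr_gt0 subr_lt0 ltNge.
pose A : {pred J} := [pred j | 0 < mu j]%N.
pose M := (\sum_j mu j)%N.
have M0 : (0 < M)%N.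
  have /= := muc None; under eq_bigr do rewrite mul1r.
  by rewrite (_ : \sum_j _ = M%:Z) // /M; elim/big_rec2: _ => // j m n _ ->; rewrite PoszD.
have MA : M = (\sum_(j in A) mu j)%N.
  rewrite /M [RHS]big_mkcond; apply: eq_bigr => j _.
  by rewrite inE; case: posnP.
have muA (T : pzRingType) (F : J -> T) :
    \sum_(j : {j | j \in A}) (mu (val j))%:R * F (val j) = \sum_j (mu j)%:R * F j.
  rewrite -(big_sub A (fun j => (mu j)%:R * F j)) /= big_mkcond /=.
  by apply: eq_bigr => j _; rewrite inE; case: posnP => // ->; rewrite mul0r.
have cK : #|{: option 'I_N}| = N.+1 by rewrite card_option card_ord.
rewrite cK in mus muB.
have AF : (#|A| <= fsize f)%N by apply: leq_trans mus (ineqs_size f).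
have MB : (M <= 2 ^ (6 * size_bound f))%N.
  apply: leq_trans (solution_sum_le (ineqs_size f)); rewrite MA -/N.
  apply: (@leq_trans (#|A| * (N.+1`! * B ^ N.+1))); last by rewrite leq_mul2r mus orbT.
  by rewrite -sum_nat_const; apply: leq_sum => j _; apply: muB.
pose y (j : {j | j \in A}) : rat := (mu (val j))%:Q / M%:Q.
have yR j : ratr (y j) = (mu (val j))%:R / M%:R :> R by rewrite rmorphM fmorphV /= !ratr_int.
have MR : M%:R != 0 :> R by rewrite pnatr_eq0 -lt0n.
pose z j : R := (mu j)%:R / M%:R.
have z1 : \sum_j z j = 1 by rewrite -mulr_suml -natr_sum divff.
have zA (F : J -> R) : \sum_(j : {j | j \in A}) ratr (y j) * F (val j) = \sum_j z j * F j.
  under eq_bigr do rewrite yR mulrAC -mulrA.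
  under [RHS]eq_bigr do rewrite /z mulrAC -mulrA.
  exact: (muA _ (fun j => F j / M%:R)).
(* The last index in a copy falls on the default empty gamble; its witness still lies in the focal
   set, so this world is harmless. *)
pose pi' (w : {j | j \in A} * 'I_(size (gambles f)).+1) p :=
  (p \in fatoms f) && pi (wit (val w.1, nth [::] (gambles f) w.2)) p.
have y1 : \sum_j (ratr (y j) : R) = 1.
  rewrite -z1; have := zA (fun=> 1).
  by under eq_bigr do rewrite mulr1; move=> ->; under eq_bigr do rewrite mulr1.
pose nu' := mixture (fun j => ratr (y j) : R)
  (fun j => [set w : {j | j \in A} * 'I_(size (gambles f)).+1 | le (val w.1) (val j)]) b.
(* The old extremum on [V j] is attained at the copy of the witness for [g], and it bounds all new
   worlds below [j], whose witnesses lie in [V i] with [V i] inside [V j]. *)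
have expE' g : g \in gambles f -> expect pi' nu' g = \sum_j z j * (v j g)%:~R.
  move=> gf; rewrite -(zA (fun j => (v j g)%:~R)).
  have pi'E w : gval pi' g w = gval pi g (wit (val w.1, nth [::] (gambles f) w.2)).
    by apply: gval_agree => p pg; rewrite /pi' (gambles_atoms gf).
  apply: (@expect_mixture _ _ _ _ _ _ _ (fun j => [set w | le (val w.1) (val j)]) b)
    => // j; split.
    have gi : (index g (gambles f) < (size (gambles f)).+1)%N by rewrite ltnS index_size.
    exists (j, Ordinal gi); first by rewrite /= le_refl.
    by rewrite pi'E /= nth_index.
  move=> w /leV wj; rewrite pi'E; have [_] := vext (val j) g; apply.
  by apply: wj; have [] := witP (val w.1, nth [::] (gambles f) w.2).
exists A; exists y; exists pi'; split.
- rewrite AF andbT lt0n; apply: contraTneq M0 => /card0_eq A0.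
  by rewrite MA big_pred0.
- split=> [j|]; first by rewrite divr_ge0.
  apply: (fmorph_inj (ratr : {rmorphism rat -> R})).
  by rewrite rmorph_sum rmorph1 -[RHS]y1.
- move=> j; apply: leq_trans (ratsize_frac_le _ M0 MB) _.
    by rewrite /M (bigD1 (val j)) //= leq_addr.
  (* With [S] the size bound, [2 * (6 * S + 1) <= 14 * S] because [S >= 1]. *)
  rewrite /size_bound; have := fsize_gt1 f; have := fmaxlen_gt0 f; nia.
- apply: (proj1 (@sat_agree R _ _ pi pi' nu _ f _) nu_sat) => q0.
  rewrite -[ineqs f]/(val (in_tuple (ineqs f))) => /tnthP [i ->]; rewrite -/(q i).
  rewrite -/(ok i) -/nu'.
  have -> : \sum_(t <- (q i).1) t.1%:~R * expect pi' nu' t.2 =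
      \sum_(t <- (q i).1) t.1%:~R * (\sum_j z j * (v j t.2)%:~R).
    by apply: eq_big_seq => t tq; rewrite expE' // (gambles_mem (qf i)).
  rewrite -[RHS]subr_ge0 -ccE //.
  have -> : \sum_j (cc (q i) j)%:~R * z j
      = (\sum_j cc (q i) j * (mu j)%:Z)%:~R / M%:R.
    rewrite rmorph_sum mulr_suml; apply: eq_bigr => j _.
    by rewrite rmorphM /= mulrA.
  rewrite pmulr_lge0 ?invr_gt0 ?ltr0n // ler0z.
  have := muc (Some i); rewrite /= ; case: (ok i) => //=.
  under eq_bigr do rewrite mulNr.
  by rewrite sumrN oppr_gt0 leNgt => ->.
- by move=> w p /negPf pf; rewrite /pi' pf.
Qed.

(** Antisymmetry makes the new focal sets distinct, so the masses are exactly the weights. Totality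
    and transitivity are asked only for possibility measures, so that equality can serve as [le] for
    belief functions. *)
Lemma small_model : antisymmetric le ->
  exists (W' : finType) (nu' : set W' -> R) (pi' : W' -> nat -> bool),
  [/\ (0 < #|W'|)%N,
      if b then is_belief nu' else total le -> transitive le -> is_possibility nu',
      sat pi' nu' f, (#|W'| <= fsize f ^ 2)%N &
      (exists m : {set W'} -> R,
         [/\ is_mass (if b then nu' else poss_dual nu') m,
             (#|[pred U : {set W'} | (0 < m U)%R]| <= fsize f)%N &
             forall U, 0 < m U -> exists q : rat,
               m U = ratr q /\ (ratsize q <= 14 * size_bound f)%N]) /\
      forall w p, p \notin fatoms f -> pi' w p = false].
Proof.
move=> le_anti.
have [A [y [pi' [/andP [A0 AF] [y0 y1] ysize satf pi'f]]]] := small_mixture.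
pose J' : finType := {j | j \in A}; pose n := (size (gambles f)).+1.
pose W' : finType := (J' * 'I_n)%type.
pose V' (j : J') : {set W'} := [set w : W' | le (val w.1) (val j)]%SET.
pose VS (j : J') : set W' := [set w | w \in V' j].
have VSE : VS = fun j => [set w | le (val w.1) (val j)].
  by apply/funext => j; apply/seteqP; split=> w; rewrite /VS /= inE.
have V'j j : (j, ord0) \in V' j by rewrite inE le_refl.
(* Each set [V' i] contains the world [(i, ord0)]; equal sets thus give [le i j] and [le j i]. *)
have V'inj : injective V'.
  move=> i j ij; apply: val_inj; apply: le_anti.
  by have := V'j i; have := V'j j; rewrite -{1}ij {2}ij !inE /= => -> ->.
have V'0 j : V' j != finset.set0 by apply/finset.set0Pn; exists (j, ord0).
have VS0 j : exists w, VS j w by exists (j, ord0); apply: V'j.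
have cardJ : #|J'| = #|A| by rewrite card_sig; apply: eq_card => j; rewrite !inE.
pose yR (j : J') : R := ratr (y j).
have yR0 j : 0 <= yR j by rewrite ler0q.
have yR1 : \sum_j yR j = 1 by rewrite -[LHS]rmorph_sum y1 rmorph1.
exists W'; exists (mixture yR VS b); exists pi'; split.
- by rewrite card_prod cardJ card_ord muln_gt0 A0.
- case: (b) => [|le_total le_trans]; first exact: mixture_belief.
  apply: (@mixture_possibility _ _ _ _ _ _ _ _ (relpre val le)) => //.
    by move=> i j; apply: le_total.
  by move=> i j ij w; rewrite /VS /= !inE => /le_trans; apply.
- by rewrite VSE.
- by rewrite card_prod cardJ card_ord expnS expn1 leq_mul // gambles_size.
- split=> //; exists (mixture_mass yR V'); split.
  + have -> : (if b then mixture yR VS b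
        else poss_dual (mixture yR VS b))
      = mixture yR VS true.
      by case: (b) => //; apply: (poss_dual_mixture V').
    exact: mixture_is_mass.
  + by apply: leq_trans (mixture_mass_card _ V'inj) _; rewrite cardJ.
  + move=> U /(mixture_mass_gt0 V'inj) [j _ ->]; exists (y j); split=> //.
Qed.

End SmallMixture.

(** * Reduction to finitely many truth assignments and conclusion *)

Lemma finite_quotient W (pi : W -> nat -> bool) (s : seq nat) :
  exists (T : finType) (h : W -> T), (forall t, exists w, h w = t) /\
    (forall w w', h w = h w' -> {in s, pi w =1 pi w'}).
Proof.
pose asg w := [ffun i : 'I_(size s) => pi w (nth 0%N s i)].
(* Keeping only the assignments realised by some world makes [h] surjective. *)
pose P := [pred a | `[< exists w, asg w = a >]].
have asgP w : P (asg w) by apply/asboolP; exists w.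
exists {a | P a}; exists (fun w => exist _ (asg w) (asgP w)); split.
  case=> a aP; have /asboolP [w wa] := aP.
  by exists w; apply: val_inj.
move=> w w' [/ffunP H] p ps.
have ip : (index p s < size s)%N by rewrite index_mem.
by have := H (Ordinal ip); rewrite !ffunE /= nth_index.
Qed.

(** Gambles of [f] are constant on the fibres of [h], so their level sets are described by
    representatives. *)
Lemma gval_preimage W (pi : W -> nat -> bool) f g (T : finType) (h : W -> T) c :
  g \in gambles f -> (forall t, exists w, h w = t) ->
  (forall w w', h w = h w' -> {in fatoms f, pi w =1 pi w'}) ->
  exists U : {set T}, [set w | c < gval pi g w] = [set w | h w \in U].
Proof.
move=> gf /choice [r rK] hpi.
exists [set t | c < gval pi g (r t)]%SET; apply/seteqP.
have E w : gval pi g (r (h w)) = gval pi g w.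
  by apply: gval_agree => p /(gambles_atoms gf); apply: hpi.
by split=> w; rewrite /= inE E.
Qed.

Theorem theorem6p2 :
  exists C : nat, forall (R : realType) (f : fml),
  (* belief structures *)
  ((exists (W : Type) (nu : set W -> R) (pi : W -> nat -> bool),
      inhabited W /\ is_belief nu /\ sat pi nu f) ->
   exists (W : finType) (nu : set W -> R) (pi : W -> nat -> bool),
     [/\ (0 < #|W|)%N, is_belief nu, sat pi nu f,
         (#|W| <= fsize f ^ 2)%N &
         ((exists m : {set W} -> R,
            [/\ is_mass nu m,
                (#|[pred V : {set W} | (0 < m V)%R]| <= fsize f)%N &
                forall V, 0 < m V -> exists q : rat,
                  m V = ratr q /\
                  (ratsize q <= C * (fsize f * fmaxlen f
                                     + fsize f * Nat.log2 (fsize f)))%N]) /\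
         forall w p, p \notin fatoms f -> pi w p = false)])
  /\
  (* possibility structures *)
  ((exists (W : Type) (nu : set W -> R) (pi : W -> nat -> bool),
      inhabited W /\ is_possibility nu /\ sat pi nu f) ->
   exists (W : finType) (nu : set W -> R) (pi : W -> nat -> bool),
     [/\ (0 < #|W|)%N, is_possibility nu, sat pi nu f,
         (#|W| <= fsize f ^ 2)%N &
         ((exists m : {set W} -> R,
            [/\ is_mass (poss_dual nu) m,
                (#|[pred V : {set W} | (0 < m V)%R]| <= fsize f)%N &
                forall V, 0 < m V -> exists q : rat,
                  m V = ratr q /\
                  (ratsize q <= C * (fsize f * fmaxlen f
                                     + fsize f * Nat.log2 (fsize f)))%N]) /\
         forall w p, p \notin fatoms f -> pi w p = false)]).
Proof.
exists 14%N => R f; split=> - [W [nu [pi [[w0] [nuP nu_sat]]]]];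
  have [T [h [hsurj hpi]]] := finite_quotient pi (fatoms f).
- have [m [m0 m_ge0 mE]] := belief_mass h nuP.
  (* Focal sets must be nonempty, so the empty index is given all of [W]; its mass is 0. *)
  pose V (j : {set T}) : set W := [set w | (j == finset.set0) || (h w \in j)].
  have V_nonempty j : exists w, V j w.
    case: (eqVneq j finset.set0) => [->|/finset.set0Pn [t tj]].
      by exists w0; rewrite /V /= eqxx.
    by have [w wt] := hsurj t; exists w; rewrite /V /= wt tj orbT.
  have nuE (U : {set T}) : nu [set w | h w \in U] = mixture m V true [set w | h w \in U].
    rewrite mE; apply: eq_bigr => j _; case: (eqVneq j finset.set0) => [->|j0].
      by rewrite m0 !mul0r.
    congr (_ * _%:R); congr nat_of_bool; rewrite /meets /V (negPf j0) /=.
    apply/fintype.subsetP/asboolP => [jU w /jU //|VU t tj].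
    by have [w wt] := hsurj t; have := VU w; rewrite /= wt; apply.
  have m1 : \sum_j m j = 1.
    have [_ nuT _ _] := nuP; rewrite -nuT.
    rewrite (_ : setT = [set w | h w \in [set: T]%SET]) ?mE.
      by apply: eq_bigr => j _; rewrite finset.subsetT mulr1.
    by apply/seteqP; split=> w //= _; rewrite inE.
  apply: (@small_model R f true W nu pi {set T} eq_op m V) => //.
  + by move=> i j /eqP ->.
  + by move=> g c gf U; have [U' UE] := gval_preimage c gf hsurj hpi; rewrite /U UE nuE.
  + by move=> i j /andP [/eqP].
- have [n [Vc [x [x0 Vc0 Vc_mono xE]]]] := possibility_chain h nuP.
  pose V (i : 'I_n) : set W := [set w | h w \in Vc i].
  have V_nonempty j : exists w, V j w.
    by have /finset.set0Pn [t tj] := Vc0 j; have [w wt] := hsurj t; exists w; rewrite /V /= wt.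
  have nuE (U : {set T}) : nu [set w | h w \in U] = mixture x V false [set w | h w \in U].
    rewrite xE; apply: eq_bigr => j _; congr (_ * _%:R); congr nat_of_bool.
    apply/pred0Pn/asboolP => [[t /andP [/= tj tU]]|[w Vw Uw]].
      by have [w wt] := hsurj t; exists w; rewrite /V /= wt.
    by exists (h w); apply/andP.
  have x1 : \sum_j x j = 1.
    have [_ nuT _] := nuP; rewrite -nuT.
    rewrite (_ : setT = [set w | h w \in [set: T]%SET]) ?xE.
      apply: eq_bigr => j _; suff -> : ~~ [disjoint Vc j & [set: T]%SET] by rewrite mulr1.
      by have /finset.set0Pn [t tj] := Vc0 j; apply/pred0Pn; exists t; rewrite /= tj inE.
    by apply/seteqP; split=> w //= _; rewrite inE.
  have leV (i j : 'I_n) : (i <= j)%N -> V i `<=` V j.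
    by move=> ij w; apply: fintype.subsetP; apply: Vc_mono.
  have nuE' g c : g \in gambles f ->
      let U := [set w | c < gval pi g w] in nu U = mixture x V false U.
    by move=> gf; have [U' /= ->] := gval_preimage c gf hsurj hpi.
  have le_anti : antisymmetric (fun i j : 'I_n => i <= j)%N.
    by move=> i j /anti_leq /val_inj.
  have [W' [nu' [pi' [W0 nuposs satf Wle mass]]]] :=
    small_model (fun i : 'I_n => leqnn i) leV x0 x1 V_nonempty nuE' nu_sat le_anti.
  exists W'; exists nu'; exists pi'; split=> //; apply: nuposs.
    by move=> i j; apply: leq_total.
  by move=> i j k; apply: leq_trans.
Qed.
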